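(* Suppose that $\inf\varphi(x,z)>-\infty$ and that each $h_i$ is differentiable with locally Lipschitz derivative. Assume further that $\varphi$ has the KL property at any point $(x,z)\in\operatorname{dom}\partial^L\varphi$ with $\psi(s)=cs^{1-\theta}$ for some $\theta\in[0,1)$ and $c>0$. If the sequence $\{x^k\}$ generated by the ADCA-Like (Accelerated DCA-Like) algorithm (described in the context) is bounded, then, with $\varphi^*=\lim_{k\to\infty}\varphi(x^k,g(x^k))$, the following statements hold. (i) If $\theta=0$, then the sequence $\{\varphi(x^k,g(x^k))\}$ converges in a finite number of steps to $\varphi^*$. (ii) If $\theta\in(0,1/2]$, then the sequence $\{\varphi(x^k,g(x^k))\}$ converges linearly to $\varphi^*$. (iii) If $\theta\in(1/2,1)$, then there exist positive constants $\delta'$ and $N_0$ such that $$\varphi(x^k,g(x^k))-\varphi^*\le\delta' k^{-\frac{1}{2\theta-1}}$$ for all $k\ge N_0$.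
   Context: Setting. $n=\sum_{i=1}^m n_i$, and $x\in\mathbb{R}^n$ is written in blocks $x=(x_1,\dots,x_m)$ with $x_i\in\mathbb{R}^{n_i}$. $X\subset\mathbb{R}^n$ is a closed convex set. $f:\mathbb{R}^n\to\mathbb{R}$ is continuously differentiable (possibly nonconvex) with $L$-Lipschitz continuous gradient. For $i=1,\dots,m$, $g_i:\mathbb{R}^{n_i}\to\mathbb{R}$ is a continuous convex (possibly nonsmooth) function. For $i=1,\dots,m$, $h_i:D_i\to\mathbb{R}$ is concave and increasing (in the sense of nondecreasing), where $D_i\subset\mathbb{R}$ is an open interval, unbounded above, containing $g_i(x_i)$ for all $x\in X$; and the convex subdifferential satisfies $\partial(-h_i)(t)\subset(-\infty,0]$ whenever $t\ge g_i(x_i)$ for some $x\in X$. Notation. $g(x)=(g_1(x_1),\dots,g_m(x_m))\in\mathbb{R}^m$; $\Omega=\{(x,z)\in\mathbb{R}^n\times\mathbb{R}^m: x\in X,\ g_i(x_i)\le z_i,\ i=1,\dots,m\}$; $\chi_\Omega=0$ on $\Omega$ and $+\infty$ elsewhere; $$\varphi(x,z)=\chi_\Omega(x,z)+f(x)+\sum_{i=1}^m h_i(z_i)$$ (equal to $+\infty$ outside $\Omega$). For $\mu>0$: $H_\mu(x,z)=\frac{\mu}{2}\|x\|^2-f(x)-\sum_{i=1}^m h_i(z_i)$. Norms are Euclidean. ADCA-Like algorithm. Inputs: $x^0\in X$, $w^0=x^0$, $\eta>1$, $0<\delta<1$, $\underline{\mu}>0$, and an initial real number $t_0$. For $k=0,1,2,\dots$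 (run without stopping, producing an infinite sequence): 1. If $\varphi(w^k,g(w^k))\le\varphi(x^k,g(x^k))$ set $v^k=w^k$, else set $v^k=x^k$. 2. Choose $\xi_i^k\in\partial(-h_i)(g_i(v_i^k))$, $i=1,\dots,m$, put $\xi^k=(\xi^k_1,\dots,\xi^k_m)$, and compute $\nabla f(v^k)$. 3. Set $\mu_k=\underline{\mu}$ if $k=0$, and $\mu_k=\max\{\underline{\mu},\delta\mu_{k-1}\}$ if $k>0$. 4. Let $x^{k+1}$ be the minimizer over $x\in X$ of $\frac{\mu_k}{2}\|x-v^k\|^2+\langle\nabla f(v^k),x\rangle+\sum_{i=1}^m(-\xi_i^k)g_i(x_i)$. 5. While $H_{\mu_k}(x^{k+1},g(x^{k+1}))<H_{\mu_k}(v^k,g(v^k))+\langle\mu_kv^k-\nabla f(v^k),x^{k+1}-v^k\rangle+\langle\xi^k,g(x^{k+1})-g(v^k)\rangle$, replace $\mu_k$ by $\eta\mu_k$ and recompute $x^{k+1}$ by step 4. 6. Compute $t_{k+1}=\frac{1+\sqrt{1+4t_k^2}}{2}$. 7. Compute $w^{k+1}=x^{k+1}+\frac{t_k-1}{t_{k+1}}(x^{k+1}-x^k)$. KL (Kurdyka-Lojasiewicz) property. For $\tau\in(0,\infty]$ let $\mathcal{M}_\tau$ be the class of continuous concave functions $\psi:[0,\tau)\to[0,\infty)$ with $\psi(0)=0$, $\psi$ continuously differentiable on $(0,\tau)$, and $\psi'(t)>0$ for all $t\in(0,\tau)$. $\partial^L\sigma$ denotes the limiting (Mordukhovich) subdifferential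 of a lower semicontinuous function $\sigma$, $\operatorname{dom}\partial^L\sigma=\{u:\partial^L\sigma(u)\ne\emptyset\}$, and $\operatorname{dist}(0,A)=\inf_{a\in A}\|a\|$ (with $\operatorname{dist}(0,\emptyset)=+\infty$). A lower semicontinuous function $\sigma$ has the KL property at $u^*\in\operatorname{dom}\partial^L\sigma$ (with the function $\psi$) if there exist $\tau>0$, a neighborhood $\mathcal{V}$ of $u^*$ and $\psi\in\mathcal{M}_\tau$ such that for all $u\in\mathcal{V}$ with $\sigma(u^* )<\sigma(u)<\sigma(u^* )+\tau$, $$\psi'(\sigma(u)-\sigma(u^* ))\,\operatorname{dist}(0,\partial^L\sigma(u))\ge1 .$$ Linear convergence of a sequence to a limit means that the distance to the limit at index $k$ is at most $Cq^k$ for all $k$, for some constants $C>0$ and $q\in(0,1)$. *)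

(* Defs.v *)
From HB Require Import structures.
From mathcomp Require Import all_boot all_order all_algebra.
From mathcomp Require Import all_classical all_reals all_analysis.

Set Implicit Arguments.
Unset Strict Implicit.
Unset Printing Implicit Defensive.

Import Order.TTheory GRing.Theory Num.Theory.
Import numFieldNormedType.Exports.

Local Open Scope classical_set_scope.
Local Open Scope ring_scope.

(** The norm carried by ['rV[R]_d] in the library is the sup norm.  It is used
    below only through the topology that it induces (which is the usual one);
    all metric quantities are written with the Euclidean norm [enorm]. *)
Section Euclidean.
Context {R : realType} {d : nat}.

Definition dot (u v : 'rV[R]_d) : R := \sum_j u 0 j * v 0 j.

Definition enorm (u : 'rV[R]_d) : R := Num.sqrt (dot u u).

(** Meaningful where [f] is differentiable. *)
Definition grad (f : 'rV[R]_d -> R) (x : 'rV[R]_d) : 'rV[R]_d :=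
  \row_j 'D_(delta_mx 0 j) f x.

Definition is_minimizer (X : set 'rV[R]_d) (F : 'rV[R]_d -> R) (y : 'rV[R]_d) :
  Prop := X y /\ forall y', X y' -> F y <= F y'.

End Euclidean.

(** The convex subdifferential at [t] of the function [F : D -> R] (a function
    given on the subset [D] of the line is a total function whose values outside
    [D] are irrelevant). *)
Definition csubdiff {R : realType} (D : set R) (F : R -> R) (t : R) : set R :=
  [set s | D t /\ forall u, D u -> F t + s * (u - t) <= F u].

Section Subdifferential.
Context {R : realType} {d : nat}.
Implicit Types (sigma : 'rV[R]_d -> \bar R) (u v : 'rV[R]_d).

(** The epsilon form of
    [liminf_(u' -> u, u' != u)
       (sigma u' - sigma u - <v, u' - u>) / |u' - u| >= 0]. *)
Definition frechet_subdiff sigma u : set 'rV[R]_d :=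
  [set v | sigma u \is a fin_num /\
    forall e : R, 0 < e ->
      \forall u' \near u,
        (sigma u + (dot v (u' - u) - e * enorm (u' - u))%:E <= sigma u')%E].

Definition limiting_subdiff sigma u : set 'rV[R]_d :=
  [set v | sigma u \is a fin_num /\
    exists us vs : nat -> 'rV[R]_d,
      [/\ us @ \oo --> u,
          (fun k => sigma (us k)) @ \oo --> sigma u,
          forall k, frechet_subdiff sigma (us k) (vs k) &
          vs @ \oo --> v]].

Definition dom_limiting_subdiff sigma : set 'rV[R]_d :=
  [set u | limiting_subdiff sigma u !=set0].

(** The infimum over the empty set is [+oo]. *)
Definition dist0 (A : set 'rV[R]_d) : \bar R :=
  ereal_inf [set (enorm a)%:E | a in A].

(** Used with [0 < tau]; the value [tau = +oo] is allowed. *)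
Definition Mclass (tau : \bar R) (psi : R -> R) : Prop :=
  let I := [set s : R | 0 <= s /\ (s%:E < tau)%E] in
  let J := [set s : R | 0 < s /\ (s%:E < tau)%E] in
  [/\ {within I, continuous psi},
      convex_function (E := R^o) I (fun s => - psi s),
      (forall s, I s -> 0 <= psi s) /\ psi 0 = 0,
      forall s, J s -> derivable psi s 1 /\ {for s, continuous (derive1 psi)} &
      forall s, J s -> 0 < derive1 psi s].

(** [sigma ustar] is finite when [ustar] is in [dom_limiting_subdiff sigma],
    and then the bounds on [sigma u] make [sigma u] finite. *)
Definition KL_at sigma (ustar : 'rV[R]_d) (psi : R -> R) : Prop :=
  exists2 tau : \bar R, (0 < tau)%E & Mclass tau psi /\
    \forall u \near ustar,
      (sigma ustar < sigma u)%E -> (sigma u < sigma ustar + tau)%E ->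
      (1 <= (derive1 psi (fine (sigma u) - fine (sigma ustar)))%:E
              * dist0 (limiting_subdiff sigma u))%E.

End Subdifferential.

Section Problem.
Context {R : realType} {m : nat} {n : 'I_m -> nat}.

Local Notation N := (\sum_(i < m) n i)%N.
Local Notation vec := 'rV[R]_(\sum_(i < m) n i).

Definition blk (x : vec) (i : 'I_m) : 'rV[R]_(n i) := submxrow x i.

Variables (X : set vec) (f : vec -> R).
Variables (g : forall i, 'rV[R]_(n i) -> R) (h : 'I_m -> R -> R).

Definition gvec (x : vec) : 'rV[R]_m := \row_i g (blk x i).

(** A pair [(x, z)] is the concatenation [row_mx x z]. *)
Definition Omega : set 'rV[R]_(N + m) :=
  [set u | X (lsubmx u) /\
           forall i, g (blk (lsubmx u) i) <= rsubmx u 0 i].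

Definition indicator_oo {T : Type} (A : set T) (u : T) : \bar R :=
  if `[< A u >] then 0%E else +oo%E.

Definition phi (u : 'rV[R]_(N + m)) : \bar R :=
  (indicator_oo Omega u
   + (f (lsubmx u) + \sum_i h i (rsubmx u 0 i))%:E)%E.

Definition phig (x : vec) : \bar R := phi (row_mx x (gvec x)).

Definition Hmu (mu : R) (x : vec) (z : 'rV[R]_m) : R :=
  mu / 2 * enorm x ^+ 2 - f x - \sum_i h i (z 0 i).

Definition subproblem (mu : R) (v : vec) (xi : 'rV[R]_m) (x : vec) : R :=
  mu / 2 * enorm (x - v) ^+ 2 + dot (grad f v) x
  + \sum_i (- xi 0 i) * g (blk x i).

Definition backtrack_test (mu : R) (v : vec) (xi : 'rV[R]_m) (y : vec) : bool :=
  Hmu mu y (gvec y) <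
    Hmu mu v (gvec v) + dot (mu *: v - grad f v) (y - v)
    + dot xi (gvec y - gvec v).

(** [backtrack eta v xi mu mu' y]: the while loop entered with the value [mu]
    stops, with the final value [mu'] and the final point [y]. *)
Inductive backtrack (eta : R) (v : vec) (xi : 'rV[R]_m) :
    R -> R -> vec -> Prop :=
| backtrack_stop mu y :
    is_minimizer X (subproblem mu v xi) y ->
    ~~ backtrack_test mu v xi y ->
    backtrack eta v xi mu mu y
| backtrack_step mu y mu' y' :
    is_minimizer X (subproblem mu v xi) y ->
    backtrack_test mu v xi y ->
    backtrack eta v xi (eta * mu) mu' y' ->
    backtrack eta v xi mu mu' y'.

(** [mu k] is the value of the parameter when the loop of iteration [k] stops.
    The initial number [t 0] is arbitrary. *)
Record adca_like (D : 'I_m -> set R) (eta delta mu_low : R)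
    (x w v : nat -> vec) (xi : nat -> 'rV[R]_m) (mu t : nat -> R) : Prop := {
  adca_x0 : X (x 0%N);
  adca_w0 : w 0%N = x 0%N;
  adca_v : forall k,
    v k = if (phig (w k) <= phig (x k))%E then w k else x k;
  adca_xi : forall k i,
    csubdiff (D i) (fun s => - h i s) (g (blk (v k) i)) (xi k 0 i);
  adca_step : forall k,
    backtrack eta (v k) (xi k)
      (if k is k'.+1 then Num.max mu_low (delta * mu k') else mu_low)
      (mu k) (x k.+1);
  adca_t : forall k, t k.+1 = (1 + Num.sqrt (1 + 4 * t k ^+ 2)) / 2;
  adca_w : forall k,
    w k.+1 = x k.+1 + ((t k - 1) / t k.+1) *: (x k.+1 - x k)
}.

End Problem.

(* Main.v *)
Require Import Defs.
From HB Require Import structures.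
From mathcomp Require Import all_boot all_order all_algebra.
From mathcomp Require Import all_classical all_reals all_analysis.
From mathcomp Require Import ring lra.

(** A step of the algorithm is governed by the variational inequality [vi],
    the optimality condition of the convex subproblem in which the differences
    of the [g i] are kept as they are.  Since [h i] is differentiable, the
    chosen [xi] is the vector [multiplier] of the numbers [- (h i)' (g i (v_i))].
    The condition is used three times.

    - Tested at [v] and combined with the stopping test of the line search, it
      gives the decrease [F y <= F v - mu / 2 * |y - v|^2] of
      [F x = phi (x, g x)] ([vi_descent]).  The parameters [mu] stay between
      [mu_low] and a constant, because the line search accepts every [mu]
      beyond twice a Taylor constant of [f] ([backtrack_bounds]).  Hence
      [F (x k)] decreases to a limit and [x (k+1) - v k] tends to zero; the
      choice of [v k] ensures [F (v k) <= F (x k)].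

    - Since [xi <= 0], it says that [(- grad f v - mu (y - v), xi)] is normal to
      [Omega] at [(y, g y)].  Adding the gradient of the smooth part yields a
      Frechet subgradient of [phi] there ([frechet_subdiff_phi]), whose norm
      is at most a constant times [|y - v|] near a given point of [X], because
      [grad f], the convex [g i] and the derivatives of the [h i] are locally
      Lipschitz.

    - It passes to the limit along a subsequence, so that an accumulation point
      [xbar] satisfies it with [y = v = xbar] ([vi_limit]).  The subgradient
      above is then zero, and the KL property holds at [(xbar, g xbar)].

    KL at [xbar] and the bound on the subgradient give
    [(F y - F xbar)^theta <= C |y - v|] near [xbar] ([local_error_bound]); a
    compactness argument extends this to all late iterates although [C]
    depends on the accumulation point ([asymptotic_error_bound]).  With the
    decrease of [F], the gaps [a k = F (x k) - lim F] satisfy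
    [a (k+1)^(2 theta) <= C' (a k - a (k+1))] as long as they are positive, and
    the three rates follow from this recursion ([finite_rate],
    [linear_rate], [sublinear_rate]).

    Estimates are made in the sup norm [`|u|] of the topology, equivalent to
    [enorm u] ([norm_le_enorm], [enorm_le]). *)

Set Implicit Arguments.
Unset Strict Implicit.
Unset Printing Implicit Defensive.

Import Order.TTheory GRing.Theory Num.Theory.
Import numFieldNormedType.Exports.

Local Open Scope classical_set_scope.
Local Open Scope ring_scope.

(** * The Euclidean product and the sup norm *)

Section Vectors.
Context {R : realType} {d : nat}.
Implicit Types u v w : 'rV[R]_d.

Lemma dotC u v : dot u v = dot v u.
Proof. by apply: eq_bigr => j _; rewrite mulrC. Qed.

Lemma dotDr u v w : dot u (v + w) = dot u v + dot u w.
Proof.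
by rewrite /dot -big_split; apply: eq_bigr => j _; rewrite mxE mulrDr.
Qed.

Lemma dotZr a u v : dot u (a *: v) = a * dot u v.
Proof.
by rewrite /dot mulr_sumr; apply: eq_bigr => j _; rewrite mxE mulrCA.
Qed.

Lemma dotNr u v : dot u (- v) = - dot u v.
Proof. by rewrite -scaleN1r dotZr mulN1r. Qed.

Lemma dotDl u v w : dot (v + w) u = dot v u + dot w u.
Proof. by rewrite dotC dotDr !(dotC u). Qed.

Lemma dotZl a u v : dot (a *: v) u = a * dot v u.
Proof. by rewrite dotC dotZr dotC. Qed.

Lemma dotNl u v : dot (- v) u = - dot v u.
Proof. by rewrite dotC dotNr dotC. Qed.

Lemma dotBl u v w : dot (v - w) u = dot v u - dot w u.
Proof. by rewrite dotDl dotNl. Qed.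

Lemma dot_ge0 u : 0 <= dot u u.
Proof. by apply: sumr_ge0 => j _; rewrite -expr2 sqr_ge0. Qed.

Lemma enorm_sqr u : enorm u ^+ 2 = dot u u.
Proof. by rewrite sqr_sqrtr ?dot_ge0. Qed.

Lemma enorm_ge0 u : 0 <= enorm u.
Proof. exact: sqrtr_ge0. Qed.

Lemma coord_le_norm u j : `|u 0 j| <= `|u|.
Proof.
by rewrite [leRHS]/Num.Def.normr/= mx_normrE (le_bigmax _ (fun ij => `|u ij.1 ij.2|) (0, j)).
Qed.

Lemma norm_le_coord u c : 0 <= c -> (forall j, `|u 0 j| <= c) -> `|u| <= c.
Proof.
move=> c0 uc; rewrite [leLHS]/Num.Def.normr/= mx_normrE; apply/bigmax_leP; split => //.
by case=> i j _ /=; rewrite ord1.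
Qed.

Lemma dot_le u v : `|dot u v| <= d%:R * (`|u| * `|v|).
Proof.
apply: le_trans (ler_norm_sum _ _ _) _.
have -> : d%:R * (`|u| * `|v|) = \sum_(j < d) `|u| * `|v|.
  by rewrite sumr_const card_ord mulr_natl.
by apply: ler_sum => j _; rewrite normrM ler_pM ?coord_le_norm.
Qed.

Lemma norm_le_enorm u : `|u| <= enorm u.
Proof.
apply: norm_le_coord => [|j]; first exact: enorm_ge0.
rewrite -(ler_pXn2r (n := 2))// ?nnegrE ?enorm_ge0// enorm_sqr real_normK ?num_real//.
by rewrite /dot (bigD1 j)//= expr2 lerDl sumr_ge0// => i _; rewrite -expr2 sqr_ge0.
Qed.

Lemma enorm_le u : enorm u <= d%:R * `|u|.
Proof.
have ud : 0 <= d%:R * `|u| by rewrite mulr_ge0.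
rewrite -(ler_pXn2r (n := 2))// ?nnegrE ?enorm_ge0// enorm_sqr.
apply: le_trans (ler_norm _) _; apply: le_trans (dot_le _ _) _.
rewrite exprMn -expr2 ler_wpM2r ?sqr_ge0// -natrX ler_nat.
by case: d => // e; rewrite -{1}(expn1 e.+1) leq_pexp2l.
Qed.

End Vectors.

Lemma dot_row_mx {R : realType} {d m : nat} (a : 'rV[R]_d) (b : 'rV[R]_m) u :
  dot (row_mx a b) u = dot a (lsubmx u) + dot b (rsubmx u).
Proof.
rewrite /dot big_split_ord; congr (_ + _); apply: eq_bigr => j _.
  by rewrite row_mxEl mxE.
by rewrite row_mxEr mxE.
Qed.

Lemma dot_sqrD {R : realType} {d : nat} (p q : 'rV[R]_d) (s : R) :
  dot (p + s *: q) (p + s *: q) =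
  dot p p + 2 * s * dot p q + s ^+ 2 * dot q q.
Proof. by rewrite dotDr !dotDl !dotZr !dotZl (dotC q p); ring. Qed.

Lemma norm_row_mx_le {R : realType} {d m : nat} (a : 'rV[R]_d) (b : 'rV[R]_m) :
  `|row_mx a b| <= `|a| + `|b|.
Proof.
apply: norm_le_coord => [|j]; first by rewrite addr_ge0.
rewrite mxE; case: splitP => k _.
  by rewrite (le_trans (coord_le_norm _ _))// lerDl.
by rewrite (le_trans (coord_le_norm _ _))// lerDr.
Qed.

Lemma norm_lsubmx_le {R : realType} {d m : nat} (u : 'rV[R]_(d + m)) :
  `|lsubmx u| <= `|u|.
Proof. by apply: norm_le_coord => // j; rewrite mxE coord_le_norm. Qed.

(** * Convexity along segments *)

Lemma convex_set_segment {R : realType} (E : lmodType R) (A : set E) x y (s : R) :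
  convex_set (M := E) A -> A x -> A y -> 0 <= s <= 1 -> A (x + s *: (y - x)).
Proof.
move=> cA Ax Ay /andP[s0 s1].
have s01 : Itv.spec (@Itv.num_sem R) (Itv.Real `[0%Z, 1%Z]) s.
  by rewrite /Itv.spec/= /Itv.num_sem/= num_real/= in_itv/= s0 s1.
have := cA y x (Itv.mk s01) (mem_set Ay) (mem_set Ax).
rewrite inE; congr A; rewrite /conv/= /unstable.onem.
by rewrite scalerBl scale1r scalerBr addrCA.
Qed.

Lemma convex_function_segment {R : realType} (E : lmodType R) (A : set E)
    (F : E -> R) x y (s : R) :
  convex_function (E := E) A F -> A x -> A y -> 0 <= s <= 1 ->
  F (x + s *: (y - x)) <= F x + s * (F y - F x).
Proof.
move=> cF Ax Ay /andP[s0 s1].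
have s01 : Itv.spec (@Itv.num_sem R) (Itv.Real `[0%Z, 1%Z]) s.
  by rewrite /Itv.spec/= /Itv.num_sem/= num_real/= in_itv/= s0 s1.
have := cF (Itv.mk s01) y x (mem_set Ay) (mem_set Ax).
have segmentE (a b : R) : s * a + (1 - s) * b = b + s * (a - b) by ring.
rewrite -segmentE; congr (F _ <= _); rewrite /conv/= /unstable.onem.
by rewrite scalerBl scale1r scalerBr addrCA.
Qed.

(** Continuity bounds the oscillation of [g] on a ball of radius [2 r] by 2.  For
    [y], [z] in the ball of radius [r], prolonging the segment from [z] to [y]
    by the length [r] stays in the larger ball, and convexity on the prolonged
    segment turns the bound on the oscillation into the slope [2 / r]. *)
Lemma convex_locally_lipschitz {R : realType} {E : normedModType R} (g : E -> R) x :
  continuous g -> convex_function (E := E) setT g ->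
  exists2 r : R, 0 < r & forall y z, `|y - x| < r -> `|z - x| < r ->
    `|g y - g z| <= 2 / r * `|y - z|.
Proof.
move=> gc gconv.
have /cvgrPdist_lt/(_ 1 ltr01)/nbhs_ballP[e /= e0 ge] := gc x.
have {}ge y : `|y - x| < e -> `|g y - g x| < 1.
  by rewrite distrC => yx; rewrite distrC; apply: ge; rewrite -ball_normE.
exists (e / 2); first by rewrite divr_gt0.
have r0 : 0 < e / 2 by rewrite divr_gt0.
set r := e / 2 in r0 *.
suff lip y z : `|y - x| < r -> `|z - x| < r -> g y - g z <= 2 / r * `|y - z|.
  move=> y z yr zr; rewrite ler_norml lip// andbT lerNl opprB distrC; exact: lip.
move=> yr zr.
have [->|yz] := eqVneq y z; first by rewrite !subrr normr0 mulr0.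
have n0 : 0 < `|y - z| by rewrite normr_gt0 subr_eq0.
(* [u] is the point at distance [r] beyond [y] on the ray from [z] *)
set s := `|y - z| / (r + `|y - z|); set u := z + s^-1 *: (y - z).
have rn0 : 0 < r + `|y - z| by rewrite addr_gt0.
have s0 : 0 < s by rewrite divr_gt0.
have yE : y = z + s *: (u - z).
  by rewrite /u addrAC subrr add0r scalerA divff ?gt_eqF// scale1r addrC subrK.
have s1 : 0 <= s <= 1 by rewrite ltW//= ler_pdivrMr// mul1r lerDr ltW.
have gu : g u - g z <= 2.
  have : `|u - x| < e.
    have -> : u - x = (y - x) + (r / `|y - z|) *: (y - z).
      rewrite /u /s invf_div mulrDl divff ?gt_eqF// scalerDl scale1r.
      by rewrite addrCA subrKC -addrA addrC.
    apply: le_lt_trans (ler_normD _ _) _.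
    rewrite normrZ gtr0_norm ?divr_gt0// divfK ?gt_eqF//.
    by rewrite [e]splitr ltrD2r.
  have : `|z - x| < e by rewrite (lt_trans zr)// /r ltr_pdivrMr//; lra.
  by move=> /ge; rewrite ltr_norml => /andP[? ?] /ge; rewrite ltr_norml; lra.
have := convex_function_segment (x := z) (y := u) gconv I I s1.
rewrite -yE -lerBlDl => h; apply: le_trans h _.
apply: le_trans (ler_wpM2l (ltW s0) gu) _.
rewrite /s mulrC -[leRHS]mulrA ler_pM2l//.
by rewrite [leRHS]mulrC ler_pM2l// lef_pV2 ?posrE// lerDl ltW.
Qed.

(** * Differential calculus and subgradients *)

Section Calculus.
Context {R : realType}.

(** Differentiability makes the derivative linear in its direction, hence
    determined by the partial derivatives that [grad] collects. *)
Lemma derive_grad {d} (f : 'rV[R]_d -> R) x v :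
  differentiable f x -> 'D_v f x = dot (grad f x) v.
Proof.
move=> dfx; rewrite deriveE// {1}(row_sum_delta v) linear_sum/=.
by apply: eq_bigr => j _; rewrite linearZ/= mxE deriveE// mulrC.
Qed.

Lemma is_derive_segment {d} (f : 'rV[R]_d -> R) x v (s : R) :
  differentiable f (x + s *: v) ->
  is_derive s 1 (fun s => f (x + s *: v)) (dot (grad f (x + s *: v)) v).
Proof.
move=> df.
have E : (fun h : R => h^-1 *: ((fun s => f (x + s *: v)) (h *: 1 + s) - f (x + s *: v)))
       = (fun h => h^-1 *: (f (h *: v + (x + s *: v)) - f (x + s *: v))).
  by apply/funext => h /=; rewrite [h%:A]mulr1 scalerDl addrCA.
apply: DeriveDef; first by rewrite /derivable E; exact: diff_derivable.
by rewrite -derive_grad// /derive E.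
Qed.

(** The mean value theorem on the segment makes the remainder equal to
    [dot (grad f c - grad f x) (y - x)] for an intermediate point [c].  The
    factor 1/2 of the integral form is lost, which only affects constants. *)
Lemma taylor_lipschitz_grad {d} (f : 'rV[R]_d -> R) (K : R) x y :
  (forall x, differentiable f x) ->
  (forall x y, `|grad f x - grad f y| <= K * `|x - y|) ->
  `|f y - f x - dot (grad f x) (y - x)| <= d%:R * K * `|y - x| ^+ 2.
Proof.
move=> fd fK.
have df (s : R) : is_derive s 1 (fun s => f (x + s *: (y - x)))
    (dot (grad f (x + s *: (y - x))) (y - x)) by apply: is_derive_segment.
have [|c] := @MVT R (fun s => f (x + s *: (y - x)))
    (fun s => dot (grad f (x + s *: (y - x))) (y - x)) 0 1 ltr01 (fun s _ => df s).
  apply: continuous_subspaceT => s.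
  apply/differentiable_continuous/derivable1_diffP.
  exact: ex_derive.
rewrite in_itv/= => /andP[c0 c1].
rewrite scale1r scale0r addr0 subrKC subr0 mulr1 => ->.
rewrite -dotBl; apply: le_trans (dot_le _ _) _.
rewrite -mulrA ler_wpM2l// expr2 mulrA ler_wpM2r//.
apply: le_trans (fK _ _) _.
have K0 : 0 <= K * `|y - x| := le_trans (normr_ge0 _) (fK y x).
rewrite addrAC subrr add0r normrZ mulrCA gtr0_norm//.
by rewrite ler_piMl// ltW.
Qed.

(** [s] minimizes [- h r - xi * r] over the open set [D], so the derivative
    vanishes there. *)
Lemma csubdiff_derive1 (D : set R) (h : R -> R) s xi :
  open D -> (forall r, D r -> derivable h r 1) ->
  csubdiff D (fun r => - h r) s xi -> xi = - derive1 h s.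
Proof.
move=> oD dh [Ds hs].
have /nbhs_ballP[e /= e0 eD] := oD _ Ds.
have dk r : D r -> is_derive r 1 (fun r => - h r - xi * r) (- derive1 h r - xi).
  move=> Dr; rewrite derive1E; have /derivableP := dh _ Dr => dhr.
  have -> : (fun r => - h r - xi * r) = - h - xi \*: id by [].
  apply: is_derive_eq; congr (_ - _); exact: mulr1.
have inD r : r \in `]s - e, s + e[ -> D r.
  rewrite in_itv/= => /andP[r1 r2]; apply: eD; rewrite /ball/= ltr_norml; lra.
have : is_derive s 1 (fun r => - h r - xi * r) 0.
  apply: (@derive1_at_min _ _ (s - e) (s + e)).
  - lra.
  - by move=> r /inD /dk/@ex_derive.
  - by rewrite in_itv/=; lra.
  - by move=> r /inD /hs; lra.
move=> /@derive_val; have := dk _ Ds => /@derive_val -> ; lra.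
Qed.

Lemma derivable_lower_bound (h : R -> R) (s e : R) : derivable h s 1 -> 0 < e ->
  \forall z \near s, h s + derive1 h s * (z - s) - e * `|z - s| <= h z.
Proof.
move=> dh e0.
have : (fun t => t^-1 *: (h (t *: 1 + s) - h s)) @ 0^' --> derive1 h s.
  by rewrite derive1E.
move/cvgrPdist_le => /(_ e e0).
rewrite near_withinE => hs.
have : \forall z \near s, (z - s) != 0 ->
    `|derive1 h s - (z - s)^-1 *: (h ((z - s) *: 1 + s) - h s)| <= e.
  move: hs => /nbhs_ballP[r /= r0 hr]; apply/nbhs_ballP; exists r => //= z zr.
  by apply: hr; rewrite /ball/= sub0r opprB.
apply: filterS => z; have [-> _|zs] := eqVneq z s.
  by rewrite subrr normr0 !mulr0 subr0 addr0.
rewrite subr_eq0 zs => /(_ isT); rewrite [_%:A]mulr1 subrK => hz.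
have zs0 : 0 < `|z - s| by rewrite normr_gt0 subr_eq0.
have : `|derive1 h s * (z - s) - (h z - h s)| <= e * `|z - s|.
  have -> : derive1 h s * (z - s) - (h z - h s) =
      (derive1 h s - (z - s)^-1 * (h z - h s)) * (z - s).
    by rewrite mulrBl mulrAC mulVf ?mul1r// subr_eq0.
  by rewrite normrM ler_pM2r.
by rewrite ler_norml => /andP[_]; lra.
Qed.

Lemma bounded_subsequence {d} (u : nat -> 'rV[R]_d) (M : R) :
  (forall k, `|u k| <= M) ->
  exists s : nat -> nat, exists2 l : 'rV[R]_d,
    forall j, (j <= s j)%N & u (s j) @[j --> \oo] --> l.
Proof.
move=> uM.
have cA : compact [set y : 'rV[R]_d | `|y| <= M].
  apply: bounded_closed_compact.
    exists M; split; first exact: num_real.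
    by move=> N MN y /= yM; rewrite (le_trans yM)// ltW.
  have -> : [set y : 'rV[R]_d | `|y| <= M] = Num.norm @^-1` [set z : R | z <= M] by [].
  by apply: closed_comp; [move=> *; exact: norm_continuous|exact: closed_le].
have uA : (u @ \oo) [set y : 'rV[R]_d | `|y| <= M] by exists 0%N => // k _ /=.
have [l [_ lcl]] := cA (u @ \oo) _ uA.
have near_l (j : nat) : exists k, (j <= k)%N /\ `|l - u k| < (j.+1%:R)^-1.
  have := lcl [set u k | k in [set k | (j <= k)%N]] (ball l (j.+1%:R)^-1).
  case.
  - by exists j => // k /= jk; exists k.
  - exact: nbhsx_ballx.
  - by move=> _ [[k /= jk <-]]; rewrite -ball_normE => ?; exists k.
have [s sP] := choice near_l.
exists s, l => [j|]; first by have [] := sP j.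
apply/cvgrPdist_lt => e e0; near=> j.
have [_ h] := sP j; apply: lt_trans h _.
near: j; exact: near_infty_natSinv_lt (PosNum e0).
Unshelve. all: by end_near. Qed.

Lemma dot_cvg {d} (u w : nat -> 'rV[R]_d) a b : u @ \oo --> a -> w @ \oo --> b ->
  dot (u k) (w k) @[k --> \oo] --> dot a b.
Proof.
move=> ua wb; rewrite /dot.
apply: cvg_big => [|j _]; first exact: add_continuous.
apply: cvgM.
  exact: (cvg_comp _ _ ua (@coord_continuous R 1 d 0 j a)).
exact: (cvg_comp _ _ wb (@coord_continuous R 1 d 0 j b)).
Qed.

Lemma derive1_KL_desingularizer (c theta s : R) : 0 < s ->
  derive1 (fun s => c * s `^ (1 - theta)) s = c * ((1 - theta) * s `^ (- theta)).
Proof.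
move=> s0; rewrite derive1E.
have -> : (fun s => c * s `^ (1 - theta)) = c \*: (@powR R ^~ (1 - theta)) by [].
have /@derive_val -> := is_deriveZ c (is_derive1_powR (1 - theta) s0).
by rewrite addrAC subrr add0r.
Qed.

Lemma limiting_subdiff_const {d} (sigma : 'rV[R]_d -> \bar R) u p :
  frechet_subdiff sigma u p -> limiting_subdiff sigma u p.
Proof.
move=> up; split; first by case: up.
by exists (fun=> u), (fun=> p); split => //; exact: cvg_cst.
Qed.

End Calculus.

(** * Rates of sequences with a power decrease *)

Section Rates.
Context {R : realType}.

(** Since [1 + s <= exp s], the left-hand side is at most [exp (r s)], and
    [exp u <= 1 + u exp u] is [1 - u <= exp (- u)] multiplied by [exp u]. *)
Lemma powR_1D_le (r s : R) : 0 <= r -> 0 <= s <= 1 ->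
  (1 + s) `^ r <= 1 + r * expR r * s.
Proof.
move=> r0 /andP[s0 s1].
have : (1 + s) `^ r <= expR (r * s).
  rewrite mulrC expRM; apply: ge0_ler_powR => //; rewrite ?nnegrE.
  - by rewrite addr_ge0.
  - exact: expR_ge0.
  - exact: expR_ge1Dx.
move=> /le_trans; apply.
have : 1 - r * s <= (expR (r * s))^-1 by rewrite -expRN expR_ge1Dx.
rewrite -(ler_pM2r (expR_gt0 (r * s))) mulVf ?gt_eqF ?expR_gt0// => h.
have : r * s * expR (r * s) <= r * s * expR r.
  by rewrite ler_wpM2l ?mulr_ge0// ler_expR ler_piMr.
rewrite (_ : r * expR r * s = r * s * expR r); last by rewrite mulrAC.
lra.
Qed.

Variables (a : nat -> R) (C theta : R) (k1 : nat).
Hypothesis a_ge0 : forall k, 0 <= a k.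
Hypothesis a_decr : forall k, a k.+1 <= a k.
Hypothesis a_cvg : a @ \oo --> 0.
Hypothesis C_gt0 : 0 < C.
Hypothesis aE : forall k, (k1 <= k)%N -> 0 < a k.+1 ->
  a k.+1 `^ (2 * theta) <= C * (a k - a k.+1).

Let a_mono k l : (k <= l)%N -> a l <= a k.
Proof.
move=> /subnKC <-; elim: (l - k)%N => [|j ih]; first by rewrite addn0.
by rewrite addnS (le_trans (a_decr _)).
Qed.

Let a_small e : 0 < e -> exists k, forall l, (k <= l)%N -> a l < e.
Proof.
move=> e0; move/cvgrPdist_lt : a_cvg => /(_ e e0)[k _ ke]; exists k => l /ke.
by rewrite sub0r normrN ger0_norm.
Qed.

(** A positive [a k.+1] would force a decrease of at least [1 / C], which is
    impossible once [a k] is smaller than that. *)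
Lemma finite_rate : theta = 0 -> exists k0, forall k, (k0 <= k)%N -> a k = 0.
Proof.
move=> t0; have [k kC] := a_small (divr_gt0 ltr01 C_gt0).
exists (maxn k k1).+1; case=> // l; rewrite ltnS geq_max => /andP[kl k1l].
apply/eqP; rewrite eq_le a_ge0 andbT leNgt; apply/negP => al.
have := aE k1l al; rewrite t0 mulr0 powRr0 leNgt => /negP; apply.
by rewrite mulrC -ltr_pdivlMr// (le_lt_trans _ (kC _ kl))// gerBl.
Qed.

(** Once [a k.+1 <= 1], the exponent [2 * theta <= 1] gives
    [a k.+1 <= a k.+1 `^ (2 * theta)], and the recursion becomes a contraction of
    ratio [C / (1 + C)]. *)
Lemma linear_rate : 0 < theta <= 1 / 2 ->
  exists K q : R, [/\ 0 < K, 0 < q < 1 & forall k, a k <= K * q ^+ k].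
Proof.
move=> /andP[t0 t1]; have [k2 k2P] := a_small ltr01.
pose q := C / (1 + C).
have C1 : 0 < 1 + C by rewrite addr_gt0.
have q0 : 0 < q by rewrite divr_gt0.
have q1 : q < 1 by rewrite ltr_pdivrMr// mul1r ltrDr.
pose k3 := maxn k1 k2.
have step k : (k3 <= k)%N -> a k.+1 <= q * a k.
  rewrite geq_max => /andP[k1k k2k].
  have [a0|/le_trans->//] := ltP 0 (a k.+1); last by rewrite mulr_ge0// ltW.
  have a1 : a k.+1 <= a k.+1 `^ (2 * theta).
    by apply: ger1_powR; [rewrite a0 ltW// k2P// leqW|lra].
  have := le_trans a1 (aE k1k a0).
  rewrite /q mulrAC ler_pdivlMr//; lra.
have geo j : a (k3 + j)%N <= a k3 * q ^+ j.
  elim: j => [|j ih]; first by rewrite addn0 mulr1.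
  rewrite addnS (le_trans (step _ _)) ?leq_addr// exprS mulrCA.
  by rewrite ler_pM2l.
have qn j : 0 < q ^+ j by rewrite exprn_gt0.
(* Dividing by [q ^+ k3] covers the indices before [k3]. *)
exists ((a 0%N + 1) / q ^+ k3), q; split; rewrite ?q0//.
  by rewrite divr_gt0// ltr_wpDl.
move=> k; rewrite mulrAC ler_pdivlMr//.
have [kk3|k3k] := leqP k k3.
  apply: ler_pM; [exact: a_ge0|exact: ltW| |].
    by rewrite (le_trans (a_mono (leq0n k)))// lerDl.
  by rewrite ler_wiXn2l// ltW.
have := geo (k - k3)%N; rewrite subnKC 1?ltnW// => h.
rewrite -{2}(subnK (ltnW k3k)) exprD mulrA ler_pM2r//.
apply: le_trans h _; rewrite ler_pM2r//.
by rewrite (le_trans (a_mono (leq0n k3)))// lerDl.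
Qed.

(** With [p = 2 * theta - 1], the quantity [a k * k^(1/p)] stays below a
    constant [K].  If it exceeded [K] for the first time at [k + 1], then
    [a k.+1 ^ p] would exceed [K^p / (k + 1)], so the recursion would make [a k]
    larger than [a k.+1 * (1 + M / k)]; that factor is at least
    [((k + 1) / k)^(1/p)] by [powR_1D_le], and [a k * k^(1/p)] would exceed [K]
    already. *)
Lemma sublinear_rate : 1 / 2 < theta < 1 ->
  exists (K : R) (N0 : nat), [/\ 0 < K, (0 < N0)%N &
    forall k, (N0 <= k)%N -> a k <= K * k%:R `^ (- (1 / (2 * theta - 1)))].
Proof.
move=> /andP[t0 t1]; pose p := 2 * theta - 1; pose r := 1 / p.
have p0 : 0 < p by rewrite /p; lra.
have r0 : 0 < r by rewrite divr_gt0.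
have rp : r * p = 1 by rewrite /r divrK// unitfE gt_eqF.
pose Y k : R := k%:R `^ r.
have Y0 k : 0 < Y k.+1 by rewrite powR_gt0.
pose M := r * expR r.
have M0 : 0 < M by rewrite mulr_gt0// expR_gt0.
pose N0 := k1.+1.
pose B : R := 2 * C * M.
have B0 : 0 < B by apply: mulr_gt0 => //; apply: mulr_gt0.
(* The second term starts the induction; the first one makes [B <= K `^ p],
   which closes the inductive step. *)
pose K := B `^ r + a N0 * Y N0.
have K0 : 0 < K.
  apply: ltr_wpDr; last exact: powR_gt0.
  by rewrite mulr_ge0 ?a_ge0 ?powR_ge0.
have Kp : B <= K `^ p.
  rewrite -[leLHS]powRr1 ?(ltW B0)//.
  rewrite -[1]rp powRrM; apply: ge0_ler_powR; rewrite ?nnegrE ?(ltW p0) ?(ltW K0)//.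
  - exact: powR_ge0.
  - by rewrite /K lerDl mulr_ge0 ?a_ge0 ?powR_ge0.
have bound j : a (N0 + j)%N * Y (N0 + j)%N <= K.
  elim: j => [|j ih]; first by rewrite addn0 /K lerDr; exact: powR_ge0.
  rewrite addnS leNgt; apply/negP => Kz.
  set k := (N0 + j)%N in ih Kz.
  have k0 : 0 < k%:R :> R by rewrite ltr0n.
  have k1' : 1 <= k%:R :> R by rewrite ler1n.
  have b0 : 0 < a k.+1 by rewrite -(pmulr_lgt0 _ (Y0 k)) (lt_trans K0).
  set b := a k.+1 in b0 Kz.
  have bp : B <= b `^ p * k.+1%:R.
    apply: le_trans Kp _.
    have -> : k.+1%:R = Y k.+1 `^ p by rewrite -powRrM rp powRr1.
    rewrite -powRM ?powR_ge0 ?(ltW b0)//.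
    apply: ge0_ler_powR; rewrite ?nnegrE.
    - exact: ltW.
    - exact: ltW.
    - by rewrite mulr_ge0 ?powR_ge0// ltW.
    - exact: ltW.
  have bC : b * b `^ p <= C * (a k - b).
    have := aE (k := k) _ b0; rewrite -/b (_ : 2 * theta = 1 + p); last by rewrite /p; lra.
    rewrite powRD ?powRr1 ?(ltW b0)//; last by rewrite (gt_eqF b0) implybT.
    by apply; rewrite /k /N0 addSn leqW// leq_addr.
  have ab : b * (1 + M / k%:R) <= a k.
    have : b * B <= C * (a k - b) * k.+1%:R.
      apply: le_trans (ler_wpM2l (ltW b0) bp) _.
      by rewrite mulrA ler_wpM2r.
    have : C * (a k - b) * k.+1%:R <= C * (a k - b) * (2 * k%:R).
      apply: ler_wpM2l; first by rewrite (le_trans _ bC)// mulr_ge0 ?powR_ge0// ltW.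
      by rewrite -natr1; lra.
    move=> /[swap] /le_trans/[apply].
    have -> : b * B = (2 * C) * (b * M) by rewrite /B; ring.
    have -> : C * (a k - b) * (2 * k%:R) = (2 * C) * ((a k - b) * k%:R) by ring.
    rewrite ler_pM2l ?mulr_gt0//.
    by rewrite -ler_pdivrMr// => ?; rewrite mulrDr mulr1 mulrA -lerBrDl.
  have Ys : Y k.+1 <= Y k * (1 + M / k%:R).
    have -> : Y k.+1 = Y k * (1 + k%:R^-1) `^ r.
      rewrite /Y -powRM// ?addr_ge0 ?invr_ge0 ?ler0n//.
      by rewrite mulrDr mulr1 divff ?gt_eqF// natr1.
    apply: ler_wpM2l; first exact: powR_ge0.
    by apply: powR_1D_le; rewrite ?(ltW r0)// invr_ge0 ler0n invf_le1.
  suff : b * Y k.+1 <= a k * Y k by lra.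
  apply: le_trans (ler_wpM2l (ltW b0) Ys) _.
  rewrite mulrCA mulrC ler_wpM2r// powR_ge0//.
exists K, N0; split => // k N0k.
rewrite powRN ler_pdivlMr ?powR_gt0 ?ltr0n ?(leq_trans _ N0k)//.
by have := bound (k - N0)%N; rewrite subnKC.
Qed.

End Rates.

(** * The subproblem and its line search *)

Lemma linear_term_ge0 {R : realFieldType} (A B : R) :
  (forall s, 0 < s <= 1 -> 0 <= s * A + s ^+ 2 * B) -> 0 <= A.
Proof.
move=> AB; rewrite leNgt; apply/negP => A0.
have B0 := normr_ge0 B; have BA : 0 < `|B| - A by lra.
(* If [A < 0], the choice [s = - A / (`|B| - A)] makes the sum negative. *)
have s0 : 0 < - A / (`|B| - A) by rewrite divr_gt0; lra.
have /AB : 0 < - A / (`|B| - A) <= 1 by rewrite s0/= ler_pdivrMr//; lra.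
rewrite expr2 -mulrA -mulrDr pmulr_rge0// leNgt => /negP; apply.
apply: (@le_lt_trans _ _ (A + - A / (`|B| - A) * `|B|)).
  by rewrite lerD2l ler_pM2l// ler_norm.
have -> : A + - A / (`|B| - A) * `|B| = - (A ^+ 2 / (`|B| - A)).
  by field; rewrite gt_eqF.
by rewrite oppr_lt0 divr_gt0// exprn_even_gt0//= lt_eqF.
Qed.

Section Blocks.
Context {R : realType} {m : nat} {n : 'I_m -> nat}.
Local Notation vec := 'rV[R]_(\sum_(i < m) n i).
Implicit Types x y : vec.

Lemma blkD x y i : blk (x + y) i = blk x i + blk y i.
Proof. by apply/rowP => j; rewrite !mxE. Qed.

Lemma blkZ (a : R) x i : blk (a *: x) i = a *: blk x i.
Proof. by apply/rowP => j; rewrite !mxE. Qed.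

Lemma blkN x i : blk (- x) i = - blk x i.
Proof. by apply/rowP => j; rewrite !mxE. Qed.

Lemma norm_blk_le x i : `|blk x i| <= `|x|.
Proof. by apply: norm_le_coord => // j; rewrite mxE coord_le_norm. Qed.

Lemma blk_continuous i : continuous (fun x => blk x i).
Proof.
move=> x; apply/(@cvgrPdist_lt _ _ _ (nbhs x) (nbhs_filter x)) => e e0.
apply/nbhs_ballP; exists e => //= y; rewrite -ball_normE /= => xy.
by rewrite -blkN -blkD (le_lt_trans (norm_blk_le _ _)).
Qed.

End Blocks.

Section Subproblem.
Context {R : realType} {m : nat} {n : 'I_m -> nat}.
Local Notation vec := 'rV[R]_(\sum_(i < m) n i).
Variables (X : set vec) (f : vec -> R) (g : forall i, 'rV[R]_(n i) -> R)
  (D : 'I_m -> set R) (h : 'I_m -> R -> R).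
Hypothesis X_convex : convex_set (M := vec) X.
Hypothesis g_convex : forall i, convex_function (E := 'rV[R]_(n i)) setT (@g i).
Implicit Types (x y v : vec) (xi : 'rV[R]_m).

Local Notation gb i x := (g (blk x i)).

Definition objective x : R := f x + \sum_i h i (gb i x).

Lemma phigE x : phig X f g h x = if `[< X x >] then (objective x)%:E else +oo%E.
Proof.
rewrite /phig /phi /indicator_oo /Omega /= row_mxKl row_mxKr /objective.
have -> : `[< X x /\ forall i, gb i x <= gvec g x 0 i >] = `[< X x >].
  by apply: asbool_equiv_eq; split => [[]//|Xx]; split => // i; rewrite mxE.
have -> : \sum_i h i (gvec g x 0 i) = \sum_i h i (gb i x).
  by apply: eq_bigr => i _; rewrite mxE.
by case: ifP => _; rewrite ?add0e.
Qed.

(** The optimality condition of the subproblem at its solution [y].  Only the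
    smooth terms are linearized at [y]; keeping the differences of the [g i]
    makes subgradients of the [g i] unnecessary. *)
Definition vi (mu : R) v xi y := forall x, X x ->
  0 <= mu * dot (y - v) (x - y) + dot (grad f v) (x - y)
       + \sum_i (- xi 0 i) * (gb i x - gb i y).

(** Compare [y] with [y + s *: (x - y)], which lies in [X]: by convexity of the
    [g i] and [- xi 0 i >= 0], the difference of the values is at most [s] times
    the right-hand side of [vi] plus a multiple of [s^2]. *)
Lemma minimizer_vi mu v xi y : (forall i, xi 0 i <= 0) ->
  is_minimizer X (subproblem f g mu v xi) y -> vi mu v xi y.
Proof.
move=> xi0 [Xy ymin] x Xx.
apply: (@linear_term_ge0 _ _ (mu / 2 * dot (x - y) (x - y))) => s /andP[s0 s1].
have s01 : 0 <= s <= 1 by rewrite ltW.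
have := ymin _ (convex_set_segment X_convex Xy Xx s01).
set z := y + s *: (x - y).
have gz : \sum_i - xi 0 i * gb i z <=
    \sum_i - xi 0 i * gb i y + s * \sum_i (- xi 0 i) * (gb i x - gb i y).
  rewrite mulr_sumr -big_split/=; apply: ler_sum => i _.
  rewrite mulrCA -mulrDr ler_wpM2l ?oppr_ge0//.
  rewrite /z blkD blkZ blkD blkN.
  exact: (convex_function_segment (@g_convex i)).
rewrite /subproblem !enorm_sqr.
have -> : z - v = (y - v) + s *: (x - y) by rewrite /z addrAC.
have -> : dot (grad f v) z = dot (grad f v) y + s * dot (grad f v) (x - y).
  by rewrite /z dotDr dotZr.
rewrite dot_sqrD.
move: gz; set S1 := \sum_i _; set S2 := \sum_i _; set S3 := \sum_i _.
rewrite expr2; nra.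
Qed.
Lemma dot_gvec xi x y :
  dot xi (gvec g y - gvec g x) = \sum_i (- xi 0 i) * (gb i x - gb i y).
Proof. by apply: eq_bigr => i _; rewrite !mxE mulNr -mulrN opprB. Qed.

Lemma Hmu_gvec mu x : Hmu f h mu x (gvec g x) = mu / 2 * dot x x - objective x.
Proof.
rewrite /Hmu /objective enorm_sqr opprD addrA; congr (_ - _).
by apply: eq_bigr => i _; rewrite mxE.
Qed.

(** The quadratic terms of [Hmu] combine with the linear one into
    [mu / 2 * |y - v|^2], so the test says that the objective exceeds a
    quadratic model around [v]. *)
Lemma backtrack_testE mu v xi y : backtrack_test f g h mu v xi y =
  (objective v + dot (grad f v) (y - v) + mu / 2 * dot (y - v) (y - v)
   - dot xi (gvec g y - gvec g v) < objective y).
Proof.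
rewrite /backtrack_test !Hmu_gvec (dotBl _ (mu *: v)) dotZl.
have -> : dot y y = dot v v + 2 * dot v (y - v) + dot (y - v) (y - v).
  have {1 2}-> : y = v + 1 *: (y - v) by rewrite scale1r subrKC.
  by rewrite dot_sqrD mulr1 expr1n mul1r.
by apply/idP/idP => ?; lra.
Qed.

(** The inequality [vi] at the point [v] bounds the linear part of the model of
    [backtrack_testE] by [- mu * |y - v|^2], and half of it remains. *)
Lemma vi_descent mu v xi y : X v -> vi mu v xi y ->
  ~~ backtrack_test f g h mu v xi y ->
  objective y <= objective v - mu / 2 * enorm (y - v) ^+ 2.
Proof.
move=> Xv /(_ _ Xv); rewrite -(opprB y v) !dotNr -dot_gvec.
rewrite backtrack_testE -leNgt enorm_sqr; lra.
Qed.

(** For large [mu] the quadratic model of [backtrack_testE] majorizes the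
    objective: the Taylor bound serves for [f], and [xi 0 i] being a subgradient
    of [- h i] serves for the rest. *)
Lemma backtrack_test_false Lf mu v xi y :
  (forall x y, `|f y - f x - dot (grad f x) (y - x)| <= Lf * `|y - x| ^+ 2) ->
  (forall i, csubdiff (D i) (fun s => - h i s) (gb i v) (xi 0 i)) ->
  (forall i, D i (gb i y)) ->
  0 <= Lf -> 2 * Lf <= mu -> ~~ backtrack_test f g h mu v xi y.
Proof.
move=> fL xiP Dy Lf0 Lmu; rewrite backtrack_testE -leNgt.
have := fL v y; rewrite ler_norml => /andP[_ fvy].
have q2 : `|y - v| ^+ 2 <= dot (y - v) (y - v).
  by rewrite -enorm_sqr ler_pXn2r ?nnegrE ?enorm_ge0// norm_le_enorm.
have hvy : \sum_i h i (gb i y) <=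
    \sum_i h i (gb i v) - dot xi (gvec g y - gvec g v).
  rewrite dot_gvec -sumrB; apply: ler_sum => i _.
  by have [_ /(_ _ (Dy i))] := xiP i; lra.
have : Lf * `|y - v| ^+ 2 <= mu / 2 * dot (y - v) (y - v).
  by apply: ler_pM; rewrite ?sqr_ge0//; lra.
rewrite /objective; lra.
Qed.

(** The parameter is increased only while it is below [2 * Lf], hence never
    beyond [eta * (2 * Lf)]. *)
Lemma backtrack_bounds Lf eta lo hi mu0 mu v xi y :
  (forall x y, `|f y - f x - dot (grad f x) (y - x)| <= Lf * `|y - x| ^+ 2) ->
  (forall i, csubdiff (D i) (fun s => - h i s) (gb i v) (xi 0 i)) ->
  (forall i x, X x -> D i (gb i x)) ->
  1 < eta -> 0 < lo -> eta * (2 * Lf) <= hi -> 0 <= Lf ->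
  backtrack X f g h eta v xi mu0 mu y -> lo <= mu0 <= hi ->
  [/\ lo <= mu <= hi, is_minimizer X (subproblem f g mu v xi) y &
    ~~ backtrack_test f g h mu v xi y].
Proof.
move=> fL xiP Dg eta1 lo0 Lhi Lf0; elim=> [{}mu {}y ymin|] //.
move=> {}mu {}y mu' y' ymin test _ ih /andP[lomu muhi]; apply: ih.
have muL : mu < 2 * Lf.
  rewrite ltNge; apply/negP => /(backtrack_test_false (y := y) fL xiP) h'.
  by move: test; apply/negP/h' => // i; apply: Dg; case: ymin.
apply/andP; split; first by nra.
by apply: le_trans Lhi; rewrite ler_pM2l ?ltW//; lra.
Qed.
End Subproblem.

(** * Subgradients of the extended objective *)

Section ErrorBound.
Context {R : realType} {m : nat} {n : 'I_m -> nat}.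
Local Notation vec := 'rV[R]_(\sum_(i < m) n i).
Variables (X : set vec) (f : vec -> R) (g : forall i, 'rV[R]_(n i) -> R)
  (D : 'I_m -> set R) (h : 'I_m -> R -> R) (Lf : R).
Hypothesis Lf_ge0 : 0 <= Lf.
Hypothesis taylor_f :
  forall x y, `|f y - f x - dot (grad f x) (y - x)| <= Lf * `|y - x| ^+ 2.
Hypothesis h_diff : forall i s, D i s -> derivable (h i) s 1.
Hypothesis D_g : forall i x, X x -> D i (g (blk x i)).
Implicit Types (x y v : vec) (xi : 'rV[R]_m).

Local Notation gb i x := (g (blk x i)).

(** The only possible value of the vector [xi] chosen at the point [v], the
    [h i] being differentiable. *)
Definition multiplier v : 'rV[R]_m := \row_i (- derive1 (h i) (gb i v)).

Lemma phi_row_mx x : X x ->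
  phi X f g h (row_mx x (gvec g x)) = (objective f g h x)%:E.
Proof. by move=> Xx; have := phigE X f g h x; rewrite asboolT. Qed.

(** Write the subgradient as the sum of [(grad f y, - multiplier y)], the
    gradient at [(y, g y)] of the smooth part of [phi], and of
    [(- grad f v - mu *: (y - v), xi)].  On [Omega] the latter has a nonpositive
    product with [(x - y, z - g y)]: since [xi <= 0] and [g x <= z], one may
    replace [z] by [g x], and this is [vi]. *)
Lemma frechet_subdiff_phi mu v xi y : X y -> (forall i, xi 0 i <= 0) ->
  vi X f g mu v xi y ->
  frechet_subdiff (phi X f g h) (row_mx y (gvec g y))
    (row_mx (grad f y - grad f v - mu *: (y - v)) (xi - multiplier y)).
Proof.
move=> Xy xi0 yvi; split; first by rewrite phi_row_mx.
move=> e e0; rewrite phi_row_mx//.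
set u := row_mx y (gvec g y).
have e2 : 0 < e / 2 by rewrite divr_gt0.
(* The slack [e] is shared: half for [f], half for the [m] terms [h i]. *)
have em : 0 < e / 2 / m.+1%:R by rewrite divr_gt0.
have near_h : \forall u' \near u, forall i : 'I_m,
    h i (gb i y) + derive1 (h i) (gb i y) * (rsubmx u' 0 i - gb i y)
      - e / 2 / m.+1%:R * `|rsubmx u' 0 i - gb i y| <= h i (rsubmx u' 0 i).
  apply: (filter_forall (nbhs_filter u)) => i.
  have hi := derivable_lower_bound (h_diff (D_g i Xy)) em.
  have ui : u 0 (rshift _ i) = gb i y by rewrite row_mxEr mxE.
  rewrite -ui in hi *.
  have := @coord_continuous _ _ _ 0 (rshift _ i) u _ hi.
  by apply: (@filterS _ _ (nbhs_filter u)) => u' /=; rewrite [rsubmx _ _ _]mxE.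
have near_f : \forall u' \near u, Lf * `|u' - u| <= e / 2.
  have Lf1 : 0 < Lf + 1 by rewrite ltr_wpDl.
  apply/nbhs_ballP; exists (e / 2 / (Lf + 1)); first by rewrite /= divr_gt0.
  move=> u'; rewrite -ball_normE /= distrC ltr_pdivlMr// mulrC => /ltW.
  by apply: le_trans; rewrite ler_wpM2r// lerDl.
apply: (@filterS2 _ _ (nbhs_filter u) _ _ _ _ near_h near_f) => u' hu' fu'.
rewrite /phi /indicator_oo; case: asboolP => [[Xx gz]|_]; last by rewrite leey.
rewrite add0e -EFinD lee_fin.
set x := lsubmx u' in Xx gz *; set z := rsubmx u' in hu' gz *.
have lE : lsubmx (u' - u) = x - y by rewrite linearB/= row_mxKl.
have rE : rsubmx (u' - u) = z - gvec g y by rewrite linearB/= row_mxKr.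
set E := `|u' - u| in fu'.
have E0 : 0 <= E := normr_ge0 _.
have xE : `|x - y| <= E by rewrite -lE norm_lsubmx_le.
have zE i : `|z 0 i - gb i y| <= E.
  have -> : z 0 i - gb i y = (u' - u) 0 (rshift _ i).
    by rewrite [RHS]mxE [X in _ = _ + X]mxE row_mxEr [X in _ = _ - X]mxE [z _ _]mxE.
  exact: coord_le_norm.
have fx : f y + dot (grad f y) (x - y) - e / 2 * E <= f x.
  have := taylor_f y x; rewrite ler_norml => /andP[+ _].
  have : Lf * `|x - y| ^+ 2 <= e / 2 * E.
    apply: (@le_trans _ _ (Lf * E * E)); last by rewrite ler_wpM2r.
    by rewrite -mulrA ler_wpM2l// -expr2 lerXn2r ?nnegrE.
  lra.
have hz : \sum_i h i (gb i y) + \sum_i derive1 (h i) (gb i y) * (z 0 i - gb i y)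
    - e / 2 * E <= \sum_i h i (z 0 i).
  have : \sum_(i < m) e / 2 / m.+1%:R * `|z 0 i - gb i y| <= e / 2 * E.
    apply: (@le_trans _ _ (\sum_(i < m) e / 2 / m.+1%:R * E)).
      by apply: ler_sum => i _; rewrite ler_wpM2l// ltW.
    rewrite sumr_const card_ord -[leLHS]mulr_natl mulrA ler_wpM2r//.
    by rewrite mulrCA ger_pMr// ler_pdivrMr// mul1r ler_nat.
  have : \sum_i (h i (gb i y) + derive1 (h i) (gb i y) * (z 0 i - gb i y)
      - e / 2 / m.+1%:R * `|z 0 i - gb i y|) <= \sum_i h i (z 0 i).
    by apply: ler_sum => i _; exact: hu'.
  by rewrite sumrB big_split/=; lra.
have viz : 0 <= mu * dot (y - v) (x - y) + dot (grad f v) (x - y)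
    + \sum_i (- xi 0 i) * (z 0 i - gb i y).
  apply: le_trans (yvi _ Xx) _; rewrite lerD2l; apply: ler_sum => i _.
  by rewrite ler_wpM2l ?oppr_ge0// lerD2r.
have dz : dot (xi - multiplier y) (z - gvec g y) =
    - \sum_i (- xi 0 i) * (z 0 i - gb i y)
    + \sum_i derive1 (h i) (gb i y) * (z 0 i - gb i y).
  rewrite -sumrN -big_split; apply: eq_bigr => i _ /=.
  by rewrite !mxE; ring.
have := norm_le_enorm (u' - u); rewrite -/E => /(ler_wpM2l (ltW e0)).
rewrite dot_row_mx lE rE dz dotBl dotBl dotZl /objective; lra.
Qed.

(** * Behaviour near a point and along the iterates *)

Hypothesis g_cont : forall i, continuous (@g i).
Hypothesis g_convex : forall i, convex_function (E := 'rV[R]_(n i)) setT (@g i).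
Hypothesis h_loc_lip : forall i s, D i s ->
     exists2 U, nbhs s U & [lipschitz derive1 (h i) r | r in U].

Lemma gblk_continuous i : continuous (fun x => gb i x).
Proof.
by move=> x; apply: continuous_comp; [exact: blk_continuous|exact: g_cont].
Qed.

Lemma derive1_gblk_locally_lipschitz i xbar : X xbar ->
  exists K r : R, [/\ 0 <= K, 0 < r & forall y v,
    `|y - xbar| < r -> `|v - xbar| < r ->
    `|derive1 (h i) (gb i y) - derive1 (h i) (gb i v)| <= K * `|y - v|].
Proof.
move=> Xx.
have [r1 r10 glip] := convex_locally_lipschitz (blk xbar i) (@g_cont i) (@g_convex i).
have [U Ux /pinfty_ex_gt0[K K0 hlip]] := h_loc_lip (D_g i Xx).
have /nbhs_ballP[r2 /= r20 r2U] := @gblk_continuous i xbar _ Ux.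
have r1ge : 0 <= 2 / r1 by rewrite divr_ge0// ltW.
exists (K * (2 / r1)), (Num.min r1 r2); split.
- by rewrite mulr_ge0// ltW.
- by rewrite lt_min r10.
move=> y v; rewrite !lt_min => /andP[y1 y2] /andP[v1 v2].
have inU z : `|z - xbar| < r2 -> U (gb i z).
  by rewrite distrC => zr; apply: r2U; rewrite -ball_normE.
have := hlip (gb i y, gb i v) (conj (inU _ y2) (inU _ v2)).
move=> /= /le_trans; apply; rewrite -mulrA ler_pM2l//.
apply: le_trans (glip _ _ _ _) _.
- by rewrite -blkN -blkD (le_lt_trans (norm_blk_le _ _)).
- by rewrite -blkN -blkD (le_lt_trans (norm_blk_le _ _)).
- by rewrite -blkN -blkD ler_wpM2l// norm_blk_le.
Qed.

Lemma multiplier_locally_lipschitz xbar : X xbar ->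
  exists K r : R, [/\ 0 <= K, 0 < r & forall y v,
    `|y - xbar| < r -> `|v - xbar| < r ->
    `|multiplier y - multiplier v| <= K * `|y - v|].
Proof.
move=> Xx.
have [K Kr] := choice (fun i => derive1_gblk_locally_lipschitz i Xx).
have [r Kr'] := choice Kr.
have near_r : \forall r' \near (0 : R)^'+, forall i, r' <= r i.
  by apply: filter_forall => i; have [_ ri _] := Kr' i; exact: nbhs_right_le ri.
have [r' [/= r'0 r'r]] := filter_ex (filterI (nbhs_right_gt 0) near_r).
have K0 i : 0 <= K i by have [] := Kr' i.
exists (\sum_i K i), r'; split => // [|y v yr vr]; first exact: sumr_ge0.
apply: norm_le_coord => [|i]; first by rewrite mulr_ge0// sumr_ge0.
rewrite !mxE -opprD normrN.
have [_ _ lip] := Kr' i.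
apply: le_trans (lip _ _ (lt_le_trans yr (r'r i)) (lt_le_trans vr (r'r i))) _.
by rewrite ler_wpM2r// (bigD1 i)//= lerDl sumr_ge0.
Qed.

Lemma multiplier_cvg (u : nat -> vec) xbar : X xbar ->
  u @ \oo --> xbar -> multiplier (u k) @[k --> \oo] --> multiplier xbar.
Proof.
move=> Xx ux; have [K [r [K0 r0 lip]]] := multiplier_locally_lipschitz Xx.
apply/cvgrPdist_lt => e e0.
have d0 : 0 < Num.min r (e / (K + 1)).
  by rewrite lt_min r0 divr_gt0// ltr_wpDl.
move/cvgrPdist_lt : ux => /(_ _ d0); apply: filterS => k.
rewrite lt_min => /andP[ur ue].
apply: le_lt_trans (lip _ _ _ _) _; rewrite ?subrr ?normr0//.
  by rewrite distrC.
move: ue; rewrite ltr_pdivlMr; last by rewrite ltr_wpDl.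
by apply: le_lt_trans; rewrite mulrC ler_wpM2l// lerDl.
Qed.

Lemma objective_continuous xbar : X xbar -> continuous f ->
  {for xbar, continuous (objective f g h)}.
Proof.
move=> Xx fc.
have hc : \sum_i h i (gb i x) @[x --> xbar] --> \sum_i h i (gb i xbar).
  apply: (cvg_big _ (nbhs_filter xbar)) => [|i _]; first exact: add_continuous.
  apply: (@continuous_comp _ _ _ (fun x => gb i x) (h i)).
    exact: gblk_continuous.
  exact/differentiable_continuous/derivable1_diffP/h_diff/D_g.
exact: cvgD (fc xbar) hc.
Qed.

Lemma row_mx_gvec_continuous : continuous (fun x : vec => row_mx x (gvec g x)).
Proof.
move=> x; apply/(@cvgrPdist_le _ _ _ (nbhs x) (nbhs_filter x)) => e e0.
have near_g : \forall y \near x, forall i, `|gb i x - gb i y| <= e.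
  apply: (filter_forall (nbhs_filter x)) => i.
  have /(@cvgrPdist_le _ _ _ (nbhs x) (nbhs_filter x)) := @gblk_continuous i x.
  exact.
have near_x : \forall y \near x, `|x - y| <= e.
  by apply/nbhs_ballP; exists e => //= y; rewrite -ball_normE /= => /ltW.
apply: (@filterS2 _ _ (nbhs_filter x) _ _ _ _ near_g near_x) => y gy xy.
apply: norm_le_coord => [|j]; first exact: ltW.
rewrite mxE [X in _ + X]mxE ![row_mx _ _ _ _]mxE; case: splitP => k _.
  by have := le_trans (coord_le_norm _ k) xy; rewrite !mxE.
by rewrite !mxE.
Qed.

(** The KL inequality at [(y, g y)] is tested with the subgradient of
    [frechet_subdiff_phi].  Its components are differences of [grad f] and of
    [multiplier] between [y] and [v], and [mu *: (y - v)], so its norm is at most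
    a constant times [|y - v|]. *)
Lemma local_error_bound (Kf hi c theta : R) xbar : X xbar ->
  (forall x y, `|grad f x - grad f y| <= Kf * `|x - y|) ->
  0 <= Kf -> 0 < c -> theta < 1 ->
  KL_at (phi X f g h) (row_mx xbar (gvec g xbar)) (fun s => c * s `^ (1 - theta)) ->
  exists C r : R, [/\ 0 <= C, 0 < r & forall mu v y, X y ->
    `|y - xbar| < r -> `|v - xbar| < r -> 0 <= mu <= hi ->
    (forall i, multiplier v 0 i <= 0) -> vi X f g mu v (multiplier v) y ->
    0 < objective f g h y - objective f g h xbar < r ->
    (objective f g h y - objective f g h xbar) `^ theta <= C * `|y - v|].
Proof.
move=> Xx fK Kf0 c0 theta1 [tau tau0 [_ klP]].
have [K [r1 [K0 r10 lip]]] := multiplier_locally_lipschitz Xx.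
have [r2 r20 klr2] : exists2 r2 : R, 0 < r2 & forall y, `|y - xbar| < r2 ->
    (phi X f g h (row_mx xbar (gvec g xbar)) < phi X f g h (row_mx y (gvec g y)))%E ->
    (phi X f g h (row_mx y (gvec g y)) < phi X f g h (row_mx xbar (gvec g xbar)) + tau)%E ->
    (1 <= (derive1 (fun s => c * s `^ (1 - theta))
            (fine (phi X f g h (row_mx y (gvec g y))) -
             fine (phi X f g h (row_mx xbar (gvec g xbar)))))%:E
         * dist0 (limiting_subdiff (phi X f g h) (row_mx y (gvec g y))))%E.
  have /nbhs_ballP[r2 /= r20 r2P] := row_mx_gvec_continuous klP.
  by exists r2 => // y yx; apply: r2P; rewrite -ball_normE /= distrC.
have [r3 r30 r3tau] : exists2 r3 : R, 0 < r3 & (r3%:E <= tau)%E.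
  case: tau tau0 {klP klr2} => [t|_|//]; last by exists 1 => //; rewrite leey.
  by rewrite lte_fin => t0; exists t.
have hi0 := normr_ge0 hi.
have t0 : 0 <= 1 - theta by rewrite subr_ge0 ltW.
have ct0 : 0 <= c * (1 - theta) by rewrite mulr_ge0 ?(ltW c0).
pose d : R := (\sum_(i < m) n i + m)%:R.
exists (c * (1 - theta) * (d * (Kf + `|hi| + K))), (Num.min (Num.min r1 r2) r3).
split.
- by rewrite mulr_ge0// mulr_ge0// !addr_ge0.
- by rewrite !lt_min r10 r20.
move=> mu v y Xy; rewrite !lt_min -!andbA => /and3P[y1 y2 _] /and3P[v1 _ _].
move=> /andP[mu0 muhi] xi0 yvi /and4P[a0 _ _ a3].
set a := objective f g h y - objective f g h xbar in a0 a3 *.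
have sub := frechet_subdiff_phi Xy xi0 yvi.
set p := row_mx (_ - _) _ in sub.
have := klr2 _ y2; rewrite !phi_row_mx// lte_fin -subr_gt0 => /(_ a0).
have /[swap]/[apply] : ((objective f g h y)%:E < (objective f g h xbar)%:E + tau)%E.
  apply: lt_le_trans (leeD2l _ r3tau).
  by rewrite -EFinD lte_fin -ltrBlDl.
rewrite /= -/a derive1_KL_desingularizer// => kl.
have kl1 : 1 <= c * ((1 - theta) * a `^ (- theta)) * enorm p.
  rewrite -lee_fin EFinM; apply: le_trans kl _.
  apply: lee_wpmul2l.
    by rewrite lee_fin mulrA mulr_ge0 ?powR_ge0.
  by apply: ereal_inf_lbound; exists p => //; exact: (limiting_subdiff_const sub).
have pn : enorm p <= d * (Kf + `|hi| + K) * `|y - v|.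
  rewrite -mulrA; apply: le_trans (enorm_le _) _.
  apply: ler_wpM2l; first exact: ler0n.
  apply: le_trans (norm_row_mx_le _ _) _.
  rewrite [leRHS]mulrDl [(Kf + _) * _]mulrDl lerD//.
    apply: le_trans (ler_normB _ _) _; rewrite lerD//.
    by rewrite normrZ ler_wpM2r// (ger0_norm mu0) (le_trans muhi)// ler_norm.
  by rewrite distrC; exact: lip.
have at0 : 0 < a `^ theta by rewrite powR_gt0.
rewrite powRN in kl1.
have : a `^ theta <= c * (1 - theta) * enorm p.
  rewrite -[leLHS]mul1r -ler_pdivlMr//.
  by apply: le_trans kl1 _; rewrite le_eqVlt; apply/orP; left; apply/eqP; ring.
by move=> /le_trans; apply; rewrite -[leRHS]mulrA ler_wpM2l.
Qed.

(** The term with [mu k] vanishes in the limit because [mu k] is bounded and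
    [y k - v k] tends to zero; the other terms are continuous in [y] and [v]. *)
Lemma vi_limit (hi : R) (mu : nat -> R) (y v : nat -> vec) xbar : X xbar ->
  continuous (grad f) -> (forall k, 0 <= mu k <= hi) ->
  y @ \oo --> xbar -> v @ \oo --> xbar ->
  (forall k, vi X f g (mu k) (v k) (multiplier (v k)) (y k)) ->
  vi X f g 0 xbar (multiplier xbar) xbar.
Proof.
move=> Xx fc muhi yx vx yvi x Xxx; rewrite mul0r add0r.
pose A k := dot (grad f (v k)) (x - y k) +
  \sum_i (- multiplier (v k) 0 i) * (gb i x - gb i (y k)).
have xy : (x - y k) @[k --> \oo] --> x - xbar by apply: cvgB => //; exact: cvg_cst.
have Acvg : A @ \oo --> dot (grad f xbar) (x - xbar) +
    \sum_i (- multiplier xbar 0 i) * (gb i x - gb i xbar).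
  apply: cvgD.
    apply: dot_cvg => //; exact: (cvg_comp _ _ vx (fc xbar)).
  apply: cvg_big => [|i _]; first exact: add_continuous.
  apply: cvgM.
    apply: cvgN.
    exact: (cvg_comp _ _ (multiplier_cvg Xx vx) (@coord_continuous _ _ _ 0 i _)).
  apply: cvgB; first exact: cvg_cst.
  exact: (cvg_comp _ _ yx (@gblk_continuous i xbar)).
have dcvg : dot (y k - v k) (x - y k) @[k --> \oo] --> 0.
  rewrite -(_ : dot (xbar - xbar) (x - xbar) = 0).
    by apply: dot_cvg => //; exact: cvgB.
  by rewrite subrr /dot big1// => j _; rewrite mxE mul0r.
have hd : hi * `|dot (y k - v k) (x - y k)| @[k --> \oo] --> hi * `|0 : R|.
  by apply: cvgM; [exact: cvg_cst|exact: cvg_norm].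
have Bcvg := cvgD (FF := eventually_filter) hd Acvg.
rewrite normr0 mulr0 add0r in Bcvg.
rewrite -(cvg_lim _ Bcvg)//; apply: limr_ge; first by apply: cvgP Bcvg.
apply: nearW => k; apply: le_trans (yvi k x Xxx) _.
rewrite -[leLHS]addrA; apply: lerD => //.
have /andP[mu0 mu1] := muhi k.
apply: le_trans (ler_norm _) _; rewrite normrM ger0_norm//.
by rewrite ler_wpM2r.
Qed.

Lemma multiplier_limit_le0 (v : nat -> vec) xbar i : X xbar -> v @ \oo --> xbar ->
  (forall k i, multiplier (v k) 0 i <= 0) -> multiplier xbar 0 i <= 0.
Proof.
move=> Xx vx v0.
have mcvg := cvg_comp _ _ (multiplier_cvg Xx vx)
  (@coord_continuous R 1 m 0 i (multiplier xbar)).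
rewrite -(cvg_lim _ mcvg)//; apply: limr_le; first by apply: cvgP mcvg.
by apply: nearW => k; exact: v0.
Qed.

(** For [mu = 0] and [y = v = xbar], the subgradient of [frechet_subdiff_phi] is
    zero. *)
Lemma critical_of_vi xbar : X xbar -> (forall i, multiplier xbar 0 i <= 0) ->
  vi X f g 0 xbar (multiplier xbar) xbar ->
  dom_limiting_subdiff (phi X f g h) (row_mx xbar (gvec g xbar)).
Proof.
move=> Xx x0 xvi; eexists; apply: limiting_subdiff_const.
exact: frechet_subdiff_phi Xx x0 xvi.
Qed.

(** The constants of [local_error_bound] depend on the accumulation point.
    If no uniform [C] existed, there would be for every [j] an index [k >= j]
    violating the bound with the constant [j + 1]; along a subsequence the corresponding
    points converge to some [xbar], where [local_error_bound] holds with a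
    constant that [j] eventually exceeds. *)
Lemma asymptotic_error_bound (Kf hi theta M phistar : R) (mu : nat -> R)
    (x v : nat -> vec) :
  closed X -> continuous f -> continuous (grad f) ->
  (forall x y, `|grad f x - grad f y| <= Kf * `|x - y|) -> 0 <= Kf ->
  theta < 1 ->
  (forall u, dom_limiting_subdiff (phi X f g h) u -> exists2 c : R, 0 < c &
    KL_at (phi X f g h) u (fun s => c * s `^ (1 - theta))) ->
  (forall k, X (x k)) -> (forall k, `|x k| <= M) ->
  (forall k, 0 <= mu k <= hi) ->
  (forall k i, multiplier (v k) 0 i <= 0) ->
  (forall k, vi X f g (mu k) (v k) (multiplier (v k)) (x k.+1)) ->
  `|x k.+1 - v k| @[k --> \oo] --> 0 ->
  objective f g h (x k) @[k --> \oo] --> phistar ->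
  exists2 C : R, 0 < C & exists k1, forall k, (k1 <= k)%N ->
    0 < objective f g h (x k.+1) - phistar ->
    (objective f g h (x k.+1) - phistar) `^ theta <= C * `|x k.+1 - v k|.
Proof.
move=> Xcl fc gfc fK Kf0 theta1 phi_KL Xx xM muhi v0 xvi dist_cvg obj_cvg.
apply: contrapT => nbound.
have viol (j : nat) : exists k, [/\ (j <= k)%N, 0 < objective f g h (x k.+1) - phistar &
    j.+1%:R * `|x k.+1 - v k| < (objective f g h (x k.+1) - phistar) `^ theta].
  apply: contrapT => nj; apply: nbound; exists j.+1%:R; first by rewrite ltr0n.
  exists j => k jk xk; rewrite leNgt; apply/negP => Ck; apply: nj.
  by exists k.
have [s0 s0P] := choice viol.
have [s1 [xbar js1 xcvg]] := bounded_subsequence (fun j => xM (s0 j).+1).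
pose s j := s0 (s1 j).
have js j : (j <= s j)%N.
  by apply: leq_trans (js1 j) _; have [] := s0P (s1 j).
have s_cvg : s @ \oo --> \oo.
  by move=> A [N _ NA]; exists N => // j /= Nj; apply: NA => /=; exact: leq_trans Nj (js j).
have ys_cvg : x (s j).+1 @[j --> \oo] --> xbar := xcvg.
have Xbar : X xbar.
  by apply: (closed_cvg _ Xcl _ _ xcvg); apply: nearW => j; exact: Xx.
have vs_cvg : v (s j) @[j --> \oo] --> xbar.
  have ds : `|x (s j).+1 - v (s j)| @[j --> \oo] --> 0 := cvg_comp _ _ s_cvg dist_cvg.
  have vE : (fun j => v (s j)) = (fun j => x (s j).+1 - (x (s j).+1 - v (s j))).
    by apply/funext => j; rewrite subKr.
  rewrite vE -[xbar]subr0; apply: cvgB => //; exact: norm_cvg0.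
have mult0 i : multiplier xbar 0 i <= 0.
  exact: (multiplier_limit_le0 (v := v \o s)) Xbar vs_cvg (fun k => v0 (s k)).
have xbar_vi : vi X f g 0 xbar (multiplier xbar) xbar.
  apply: (vi_limit (mu := mu \o s) (y := fun j => x (s j).+1) (v := v \o s)) => //.
  - by move=> k; exact: muhi.
  - by move=> k; exact: xvi.
have [c c0 KLc] := phi_KL _ (critical_of_vi Xbar mult0 xbar_vi).
have [C [r [C0 r0 bound]]] := local_error_bound hi Xbar fK Kf0 c0 theta1 KLc.
have objE : objective f g h xbar = phistar.
  have sS_cvg : (fun j => (s j).+1) @ \oo --> \oo.
    by move=> A [N _ NA]; exists N => // j /= Nj; apply/NA/leqW/(leq_trans Nj)/js.
  have c1 := cvg_comp _ _ sS_cvg obj_cvg.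
  have c2 := cvg_comp _ _ ys_cvg (objective_continuous Xbar fc).
  by rewrite -(cvg_lim _ c1)//; apply/esym/(cvg_lim _ c2).
rewrite objE in bound.
have near_y : \forall j \near \oo, `|x (s j).+1 - xbar| < r.
  by move/cvgrPdist_lt : ys_cvg => /(_ r r0); apply: filterS => j; rewrite distrC.
have near_v : \forall j \near \oo, `|v (s j) - xbar| < r.
  by move/cvgrPdist_lt : vs_cvg => /(_ r r0); apply: filterS => j; rewrite distrC.
have near_obj : \forall j \near \oo, objective f g h (x (s j).+1) - phistar < r.
  have [k _ kP] := (cvgrPdist_lt _ _).1 obj_cvg r r0.
  exists k => // j /= kj; have := kP _ (leqW (leq_trans kj (js j))).
  by rewrite distrC; apply: le_lt_trans; exact: ler_norm.
have near_C : \forall j \near \oo, C <= j%:R by exact: nbhs_infty_ger.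
have [j [[jy jv] [jobj jC]]] :=
  filter_ex (filterI (filterI near_y near_v) (filterI near_obj near_C)).
have [_ obj0] := s0P (s1 j); rewrite -/(s j) ltNge => /negP; apply.
apply: le_trans (bound (mu (s j)) (v (s j)) _ (Xx _) jy jv (muhi _) (v0 _) (xvi _) _) _.
  by rewrite obj0.
rewrite ler_wpM2r// (le_trans jC)// ler_nat leqW//.
Qed.

End ErrorBound.

(** * Convergence rates of the algorithm *)

Theorem theorem4 (R : realType) (m : nat) (n : 'I_m -> nat)
  (X : set 'rV[R]_(\sum_(i < m) n i))
  (f : 'rV[R]_(\sum_(i < m) n i) -> R)
  (L : R)
  (g : forall i : 'I_m, 'rV[R]_(n i) -> R)
  (D : 'I_m -> set R)
  (h : 'I_m -> R -> R)
  (* standing assumptions *)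
  (X_closed : closed X)
  (X_convex : convex_set (M := 'rV[R]_(\sum_(i < m) n i)) X)
  (f_diff : forall x, differentiable f x)
  (f_C1 : continuous (grad f))
  (f_smooth : forall x y, enorm (grad f x - grad f y) <= L * enorm (x - y))
  (g_cont : forall i, continuous (g i))
  (g_convex : forall i, convex_function (E := 'rV[R]_(n i)) setT (g i))
  (D_open : forall i, open (D i))
  (D_itv : forall i, is_interval (D i))
  (D_unbounded : forall i, ~ has_ubound (D i))
  (D_g : forall i x, X x -> D i (g i (blk x i)))
  (h_concave : forall i, convex_function (E := R^o) (D i) (fun s => - h i s))
  (h_incr : forall i, {in D i &, {homo h i : s t / s <= t}})
  (h_subdiff : forall i x t, X x -> g i (blk x i) <= t ->
     csubdiff (D i) (fun s => - h i s) t `<=` [set s | s <= 0])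
  (* the algorithm *)
  (eta delta mu_low : R)
  (eta_gt1 : 1 < eta)
  (delta_gt0 : 0 < delta)
  (delta_lt1 : delta < 1)
  (mu_low_gt0 : 0 < mu_low)
  (x w v : nat -> 'rV[R]_(\sum_(i < m) n i))
  (xi : nat -> 'rV[R]_m)
  (mu t : nat -> R)
  (run : adca_like X f g h D eta delta mu_low x w v xi mu t)
  (* assumptions of the theorem *)
  (phi_bounded_below : (-oo < ereal_inf (range (phi X f g h)))%E)
  (h_diff : forall i s, D i s -> derivable (h i) s 1)
  (h_loc_lip : forall i s, D i s ->
     exists2 U, nbhs s U & [lipschitz derive1 (h i) r | r in U])
  (theta : R)
  (theta_ge0 : 0 <= theta)
  (theta_lt1 : theta < 1)
  (phi_KL : forall u, dom_limiting_subdiff (phi X f g h) u ->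
     exists2 c : R, 0 < c &
       KL_at (phi X f g h) u (fun s => c * s `^ (1 - theta)))
  (x_bounded : exists M : R, forall k, enorm (x k) <= M) :
  exists phi_star : R,
    [/\ (fun k => phig X f g h (x k)) @ \oo --> phi_star%:E,
        theta = 0 ->
          exists k0 : nat, forall k, (k0 <= k)%N ->
            phig X f g h (x k) = phi_star%:E,
        0 < theta <= 1 / 2 ->
          exists C q : R, [/\ 0 < C, 0 < q < 1 &
            forall k, (`|phig X f g h (x k) - phi_star%:E|
                        <= (C * q ^+ k)%:E)%E] &
        1 / 2 < theta < 1 ->
          exists (delta' : R) (N0 : nat), [/\ 0 < delta', (0 < N0)%N &
            forall k, (N0 <= k)%N ->
              (phig X f g h (x k) - phi_star%:E
                <= (delta' * k%:R `^ (- (1 / (2 * theta - 1))))%:E)%E]].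
Proof.
set F := objective f g h.
pose N := (\sum_(i < m) n i)%N.
(* [L] itself may be negative when the space is trivial. *)
pose Kf : R := `|L| * N%:R.
have Kf0 : 0 <= Kf by rewrite mulr_ge0.
have fK a b : `|grad f a - grad f b| <= Kf * `|a - b|.
  apply: le_trans (norm_le_enorm _) _; apply: le_trans (f_smooth a b) _.
  apply: (@le_trans _ _ (`|L| * enorm (a - b))).
    by rewrite ler_wpM2r ?enorm_ge0 ?ler_norm.
  by rewrite -mulrA ler_wpM2l// enorm_le.
pose Lf : R := N%:R * Kf.
have Lf0 : 0 <= Lf by rewrite mulr_ge0.
have fL a b : `|f b - f a - dot (grad f a) (b - a)| <= Lf * `|b - a| ^+ 2.
  exact: taylor_lipschitz_grad.
have fc : continuous f by move=> a; exact: differentiable_continuous.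
have [b phib] : exists b : R, forall u, (b%:E <= phi X f g h u)%E.
  case E : (ereal_inf (range (phi X f g h))) phi_bounded_below => [b| |] //= _.
    by exists b => u; rewrite -E; apply: ereal_inf_lbound; exists u.
  exists 0 => u; apply: (@le_trans _ _ +oo%E); first by rewrite leey.
  by rewrite -E; apply: ereal_inf_lbound; exists u.
have phiF a : X a -> phig X f g h a = (F a)%:E by move=> Xa; rewrite phigE asboolT.
have [M xM] := x_bounded.
case: run => X0 w0 vE xiE step _ _.
pose hi : R := Num.max mu_low (eta * (2 * Lf)).
have v_ok k : X (x k) -> X (v k) /\ F (v k) <= F (x k).
  move=> Xk; rewrite vE; have [|_ //] := boolP (phig X f g h (w k) <= phig X f g h (x k))%E.
  by rewrite (phiF _ Xk) phigE; case: asboolP => // Xw; rewrite lee_fin.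
have xi_le0 k i : X (v k) -> xi k 0 i <= 0.
  by move=> Xv; exact: (h_subdiff i (v k) _ Xv (lexx _) _ (xiE k i)).
have xiM k : xi k = multiplier g h (v k).
  apply/rowP => i; rewrite mxE.
  exact: csubdiff_derive1 (D_open i) (@h_diff i) (xiE k i).
have lo_hi : mu_low <= hi by rewrite le_max lexx.
have one_step k : X (x k) ->
    mu_low <= (if k is k'.+1 then Num.max mu_low (delta * mu k') else mu_low) <= hi ->
    [/\ mu_low <= mu k <= hi, X (x k.+1),
        vi X f g (mu k) (v k) (multiplier g h (v k)) (x k.+1) &
        F (x k.+1) <= F (v k) - mu k / 2 * enorm (x k.+1 - v k) ^+ 2].
  move=> Xk mu0; have [Xv _] := v_ok _ Xk.
  have [] := backtrack_bounds fL (xiE k) D_g eta_gt1 mu_low_gt0 _ Lf0 (step k) mu0.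
    by rewrite le_max lexx orbT.
  move=> muk ymin test.
  have yvi := minimizer_vi X_convex g_convex (xi_le0 k ^~ Xv) ymin.
  split => //; [by case: ymin|by rewrite -xiM|exact: vi_descent Xv yvi test].
(* The bound on the initial value of the line search needs the bound on the
   previous final value, so both are proved together with feasibility. *)
have Xx_mu k : X (x k) /\
    mu_low <= (if k is k'.+1 then Num.max mu_low (delta * mu k') else mu_low) <= hi.
  elim: k => [|k [Xk muk]]; first by rewrite lexx.
  have [/andP[lomu muhi] Xk1 _ _] := one_step k Xk muk.
  split => //; rewrite le_max lexx/= ge_max lo_hi/=.
  apply: le_trans muhi; rewrite ler_piMl ?ltW//.
  exact: lt_le_trans lomu.
have Xx k : X (x k) by have [] := Xx_mu k.
have iter k := one_step k (Xx_mu k).1 (Xx_mu k).2.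
have Xv k : X (v k) by have [] := v_ok _ (Xx k).
have dec k : F (x k.+1) <= F (x k) - mu_low / 2 * `|x k.+1 - v k| ^+ 2.
  have [/andP[lomu _] _ _ Fk] := iter k; have [_ Fv] := v_ok _ (Xx k).
  apply: le_trans Fk _; apply: lerB => //.
  apply: ler_pM.
  - by rewrite divr_ge0// ltW.
  - exact: sqr_ge0.
  - by rewrite ler_pM2r// invr_gt0.
  - by rewrite lerXn2r ?nnegrE ?enorm_ge0 ?norm_le_enorm.
have Fdecr k : F (x k.+1) <= F (x k).
  apply: le_trans (dec k) _.
  by rewrite gerBl mulr_ge0 ?sqr_ge0// divr_ge0// ltW.
have Fcvg : cvgn (fun k => F (x k)).
  apply: nonincreasing_is_cvgn; first by apply/nonincreasing_seqP.
  by exists b => _ [k _ <-]; rewrite -lee_fin -phiF//; exact: phib.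
pose phistar : R := limn (fun k => F (x k)).
have Flim : F (x k) @[k --> \oo] --> phistar := Fcvg.
have Fge k : phistar <= F (x k).
  by apply: nonincreasing_cvgn_ge => //; apply/nonincreasing_seqP.
pose a k := F (x k) - phistar.
have a_ge0 k : 0 <= a k by rewrite subr_ge0.
have a_decr k : a k.+1 <= a k by rewrite lerD2r.
have a_cvg : a @ \oo --> 0.
  by rewrite -(subrr phistar); apply: cvgB => //; exact: cvg_cst.
have da k : `|x k.+1 - v k| ^+ 2 <= 2 / mu_low * (a k - a k.+1).
  rewrite mulrAC ler_pdivlMr// /a; have := dec k; lra.
have dist_cvg : `|x k.+1 - v k| @[k --> \oo] --> 0.
  apply/cvgr0Pnorm_lt => e e0.
  have ae0 : 0 < mu_low / 2 * e ^+ 2 by rewrite mulr_gt0 ?exprn_gt0// divr_gt0.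
  have /cvgr0Pnorm_lt/(_ _ ae0) := a_cvg; apply: filterS => k ak.
  rewrite normr_id -(ltr_pXn2r (n := 2))// ?nnegrE ?(ltW e0)//.
  apply: le_lt_trans (da k) _; rewrite mulrAC ltr_pdivrMr//.
  have := a_ge0 k.+1; have := le_lt_trans (ler_norm _) ak; lra.
have x_norm k : `|x k| <= M := le_trans (norm_le_enorm _) (xM k).
have mu_hi k : 0 <= mu k <= hi.
  by have [/andP[/(lt_le_trans mu_low_gt0)/ltW -> ->]] := iter k.
have mult_le0 k i : multiplier g h (v k) 0 i <= 0 by rewrite -xiM xi_le0.
have vi_x k : vi X f g (mu k) (v k) (multiplier g h (v k)) (x k.+1).
  by have [] := iter k.
have [C C0 [k1 bound]] := asymptotic_error_bound Lf0 fL h_diff D_g g_cont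
  g_convex h_loc_lip X_closed fc f_C1 fK Kf0 theta_lt1 phi_KL Xx x_norm mu_hi
  mult_le0 vi_x dist_cvg Flim.
have K0 : 0 < C ^+ 2 * (2 / mu_low) by rewrite mulr_gt0 ?exprn_gt0// divr_gt0.
have aE k : (k1 <= k)%N -> 0 < a k.+1 ->
    a k.+1 `^ (2 * theta) <= C ^+ 2 * (2 / mu_low) * (a k - a k.+1).
  move=> k1k ak; rewrite mulrC powRrM powR_mulrn ?powR_ge0//.
  apply: (@le_trans _ _ ((C * `|x k.+1 - v k|) ^+ 2)).
    rewrite lerXn2r ?nnegrE ?powR_ge0 ?mulr_ge0 ?(ltW C0)//.
    exact: bound.
  by rewrite exprMn -[leRHS]mulrA ler_wpM2l ?sqr_ge0.
have phia k : (phig X f g h (x k) - phistar%:E)%E = (a k)%:E.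
  by rewrite phiF// -EFinB.
exists phistar; split.
- rewrite (_ : (fun k => _) = (fun k => (F (x k))%:E)); last first.
    by apply/funext => k; rewrite phiF.
  by apply: cvg_EFin => //; exact: nearW.
- move=> t0; have [k0 k0P] := finite_rate a_ge0 a_cvg K0 aE t0.
  exists k0 => k /k0P/eqP; rewrite subr_eq0 => /eqP Fk.
  by rewrite phiF// Fk.
- move=> t01; have [C' [q [C'0 q01 aq]]] := linear_rate a_ge0 a_decr a_cvg K0 aE t01.
  by exists C', q; split => // k; rewrite phia /= ger0_norm// lee_fin.
- move=> t12; have [K [N0 [K'0 N00 aK]]] := sublinear_rate a_ge0 K0 aE t12.
  by exists K, N0; split => // k N0k; rewrite phia lee_fin aK.
Qed.
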